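(* Let $\Lambda$ be a commutative Noetherian ring in which linear equations are solvable and which has effective coset representatives. Let $I=\langle\nu_1,\ldots,\nu_s\rangle$ be a proper ideal of $\Lambda$, $R=\Lambda/I$, $T=\Lambda[x_1,\ldots,x_n]$, $A=R[x_1,\ldots,x_n]$, and $\varphi:T\to A$ the canonical epimorphism reducing coefficients modulo $I$. Let $\overline J=\langle\overline f_1,\ldots,\overline f_t\rangle$ be an ideal of $A$, let $f_i\in T$ be obtained from $\overline f_i$ by replacing each (nonzero) coefficient by a representative in $\Lambda$, let $J=\langle f_1,\ldots,f_t,\nu_1,\ldots,\nu_s\rangle\subseteq T$, and let $\mathcal G$ be a Gröbner basis of $J$ with respect to a monomial ordering $\prec$. Then a complete set of coset representatives for $A/\overline J$ can be obtained by constructing a complete set of coset representatives for $T/J$: if $C\subset T$ is the complete set of coset representatives for $T/J$ consisting of the polynomials that are totally reduced with respect to $\mathcal G$, then the elements $\varphi(f)$, $f\in C$, represent each coset of $\overline J$ in $A$ exactly once.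
   Context: Linear equations are solvable in $\Lambda$ if there are algorithms (1) deciding, for $\lambda,\lambda_1,\ldots,\lambda_m\in\Lambda$, whether $\lambda\in\langle\lambda_1,\ldots,\lambda_m\rangle$ and in that case computing $\mu_i$ with $\lambda=\sum\lambda_i\mu_i$, and (2) computing generators of the syzygy module $\{(\mu_i)\in\Lambda^m\mid\sum\lambda_i\mu_i=0\}$. $\Lambda$ has effective coset representatives if for every ideal $\mathfrak a$ of $\Lambda$ there is a procedure to determine a complete set of coset representatives $C_{\mathfrak a}$ (with $0\in C_{\mathfrak a}$) of $\Lambda/\mathfrak a$ and, for each $\lambda\in\Lambda$, a procedure to find $c\in C_{\mathfrak a}$ with $\lambda\equiv c\bmod\mathfrak a$. For a nonzero polynomial $f$, $\mathbf{LM}(f)$ is its $\prec$-largest monomial, $\mathbf{LC}(f)$ the corresponding coefficient, $\mathbf{LT}(f)=\mathbf{LC}(f)\mathbf{LM}(f)$. A finite set $\mathcal G$ of nonzero elements of $J$ is a Gröbner basis of $J$ if $\langle\mathbf{LT}(J)\rangle=\langle\mathbf{LT}(\mathcal G)\rangle$. Totally reduced polynomials: for a monomial $X$ let $\mathfrak a_X$ be the ideal of $\Lambda$ generated by the $\mathbf{LC}(g)$ with $g\in\mathcal G$ and $\mathbf{LM}(g)\mid X$, and fix a complete set $C_{\mathfrak a_X}$ of coset representatives of $\Lambda/\mathfrak a_X$ containing $0$ (depending only on the ideal $\mathfrak a_X$). A polynomial $f=\sum_Xa_XX\in T$ is totally reduced with respect to $\mathcal G$ if $a_X\in C_{\mathfrak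 a_X}$ for every monomial $X$. *)

(* Defs.v *)
From HB Require Import structures.
From mathcomp Require Import all_boot all_order all_algebra.
From mathcomp Require Import mpoly.

Set Implicit Arguments.
Unset Strict Implicit.
Unset Printing Implicit Defensive.

Import GRing.Theory.
Local Open Scope ring_scope.

(* MathComp's [idealr] covers only proper ideals; the ideals below may be the
   whole ring, as happens for the ideals of leading coefficients. *)
Record ideal (A : comNzRingType) := Ideal {
  ideal_mem :> A -> Prop;
  ideal_mem0 : ideal_mem 0;
  ideal_memD : forall x y, ideal_mem x -> ideal_mem y -> ideal_mem (x + y);
  ideal_memM : forall a x, ideal_mem x -> ideal_mem (a * x)
}.

Section Ideals.
Variable A : comNzRingType.
Implicit Types (S : A -> Prop) (a : ideal A) (s : seq A).

Definition lin_comb S (x : A) : Prop :=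
  exists2 c : seq (A * A),
    (forall p, p \in c -> S p.2) & x = \sum_(p <- c) p.1 * p.2.

Fact lin_comb0 S : lin_comb S 0.
Proof. by exists [::]; rewrite ?big_nil. Qed.

Fact lin_combD S x y : lin_comb S x -> lin_comb S y -> lin_comb S (x + y).
Proof.
move=> [c hc ->] [d hd ->]; exists (c ++ d); last by rewrite big_cat.
by move=> p; rewrite mem_cat => /orP[/hc | /hd].
Qed.

Fact lin_combM S b x : lin_comb S x -> lin_comb S (b * x).
Proof.
move=> [c hc ->]; exists [seq (b * p.1, p.2) | p <- c].
  by move=> p /mapP[q /hc hq ->].
by rewrite big_map mulr_sumr; apply: eq_bigr => p _; rewrite mulrA.
Qed.

Definition ideal_gen S : ideal A :=
  Ideal (@lin_comb0 S) (@lin_combD S) (@lin_combM S).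

Definition ideal_span s : ideal A := ideal_gen (fun x => x \in s).

Definition noetherian : Prop :=
  forall a, exists s, forall x, a x <-> ideal_span s x.

Definition complete_coset_reps a (C : A -> Prop) : Prop :=
  forall x, exists! c, C c /\ a (x - c).

(* Algorithms are rendered as functions, so this structure and the two
   below it live in Type. *)
Record linear_equations_solvable := LinearEquationsSolvable {
  solve_membership : forall (m : nat) (l : 'I_m -> A) (x : A),
    {mu : 'I_m -> A | x = \sum_(i < m) l i * mu i}
    + {~ ideal_span (codom l) x};
  syzygy_generators : forall (m : nat) (l : 'I_m -> A),
    {g : seq 'rV[A]_m | forall mu : 'rV[A]_m,
       \sum_(i < m) l i * mu 0 i = 0 <->
       exists c : 'I_(size g) -> A, mu = \sum_(j < size g) c j *: g`_j}
}.

Record coset_procedure a := CosetProcedure {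
  reps : {pred A};
  reps0 : 0 \in reps;
  reps_complete : complete_coset_reps a (fun c => c \in reps);
  repr_of : A -> A;
  repr_of_in : forall x, repr_of x \in reps;
  repr_of_mod : forall x, a (x - repr_of x)
}.

Definition effective_coset_reps : Type := forall a, coset_procedure a.

End Ideals.

Record monomial_order (n : nat) (le : rel 'X_{1..n}) : Prop := MonomialOrder {
  mon_refl : reflexive le;
  mon_anti : antisymmetric le;
  mon_trans : transitive le;
  mon_total : total le;
  mon_add : forall m1 m2 m, le m1 m2 -> le (m1 + m)%MM (m2 + m)%MM;
  mon_wf : well_founded (fun m1 m2 => (m1 != m2) && le m1 m2)
}.

Section Leading.
Variables (L : comNzRingType) (n : nat) (le : rel 'X_{1..n}).
Local Notation T := {mpoly L[n]}.
Implicit Types (f g : T) (J : ideal T) (G : seq T).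

(* 0%MM is the least monomial for a monomial order, so it is a neutral
   starting value for this maximum; LM 0 is the junk value 0%MM. *)
Definition LM f : 'X_{1..n} :=
  \big[(fun m1 m2 => if le m1 m2 then m2 else m1)/0%MM]_(m <- msupp f) m.
Definition LC f : L := f@_(LM f).
Definition LT f : T := LC f *: 'X_[LM f].

Definition groebner_basis J G : Prop :=
  (forall g, g \in G -> g != 0 /\ J g) /\
  (forall h,
     ideal_gen (fun u => exists f, [/\ J f, f != 0 & u = LT f]) h <->
     ideal_gen (fun u => exists2 g, g \in G & u = LT g) h).

Definition lc_ideal G (X : 'X_{1..n}) : ideal L :=
  ideal_gen (fun c => exists g, [/\ g \in G, (LM g <= X)%MM & c = LC g]).

Definition totally_reduced (E : effective_coset_reps L) G f : Prop :=
  forall X : 'X_{1..n}, f@_X \in reps (E (lc_ideal G X)).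

End Leading.

Section Reduction.
Variables (L : comNzRingType) (I : idealr L) (n : nat).

Definition coset_of_I (x : L) : {ideal_quot I} := (\pi x)%qT.

Definition reduce_coeffs (f : {mpoly L[n]}) : {mpoly {ideal_quot I}[n]} :=
  map_mpoly coset_of_I f.

Definition coeff_lift (fbar : {mpoly {ideal_quot I}[n]}) (f : {mpoly L[n]}) :=
  forall X, if fbar@_X == 0 then f@_X = 0 else coset_of_I f@_X = fbar@_X.

End Reduction.

(* Main.v *)
(* Everything in T whose coefficients lie in I belongs to J, so J is the full
   preimage of Jbar under phi, and phi carries representatives of T/J to
   representatives of A/Jbar. For T/J: the coefficient ideals a_X increase with
   X for divisibility, so the polynomials with all X-coefficients in a_X form an
   ideal; it contains LT(G), hence LT(J). If two congruent totally reduced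
   polynomials differed, their coefficients at the leading monomial X of the
   difference would be distinct representatives of one coset of a_X. Existence is by well-founded induction on a bound for the support,
   normalizing the top coefficient at each step. *)
Require Import Defs.
From HB Require Import structures.
From mathcomp Require Import all_boot all_order all_algebra.
From mathcomp Require Import mpoly.

Set Implicit Arguments.
Unset Strict Implicit.
Unset Printing Implicit Defensive.

Import GRing.Theory.
Local Open Scope ring_scope.

(** * Closure properties of ideals and minimality of the generated ideal *)

Section IdealTheory.
Variable A : comNzRingType.
Implicit Types (S : A -> Prop) (a : ideal A).

Lemma ideal_memN a x : a x -> a (- x).
Proof. by rewrite -mulN1r; apply: ideal_memM. Qed.

Lemma ideal_memB a x y : a x -> a y -> a (x - y).
Proof. by move=> ax /ideal_memN; apply: ideal_memD. Qed.

Lemma ideal_mem_sum a (K : Type) (r : seq K) (P : pred K) (F : K -> A) :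
  (forall k, P k -> a (F k)) -> a (\sum_(k <- r | P k) F k).
Proof. by move=> aF; apply: big_ind => //; [apply: ideal_mem0 | apply: ideal_memD]. Qed.

Lemma mem_ideal_gen S x : S x -> ideal_gen S x.
Proof.
by move=> Sx; exists [:: (1, x)]; [move=> p /[!inE] /eqP-> | rewrite big_seq1 mul1r].
Qed.

Lemma ideal_gen_min S a :
  (forall x, S x -> a x) -> forall x, ideal_gen S x -> a x.
Proof.
move=> sSa _ [c Sc ->]; rewrite big_seq; apply: ideal_mem_sum => p /Sc /sSa.
exact: ideal_memM.
Qed.

End IdealTheory.

Section Preimage.
Variables (A B : comNzRingType) (f : {rmorphism A -> B}) (b : ideal B).

Fact preim_ideal0 : b (f 0).
Proof. by rewrite rmorph0; apply: ideal_mem0. Qed.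

Fact preim_idealD x y : b (f x) -> b (f y) -> b (f (x + y)).
Proof. by rewrite rmorphD; apply: ideal_memD. Qed.

Fact preim_idealM c x : b (f x) -> b (f (c * x)).
Proof. by rewrite rmorphM; apply: ideal_memM. Qed.

(** Packaging a preimage as an ideal lets [ideal_gen_min] reduce a membership claim about images to
    the generators. *)
Definition preim_ideal : ideal A :=
  @Ideal A (fun x => b (f x)) preim_ideal0 preim_idealD preim_idealM.

End Preimage.

(** * Coefficient reduction as a surjective ring morphism *)

Section Reduction.
Variables (L : comNzRingType) (I : idealr L) (n : nat).
Local Notation T := {mpoly L[n]}.

HB.instance Definition _ :=
  GRing.RMorphism.copy (@coset_of_I L I) (\pi_({ideal_quot I})%qT).

HB.instance Definition _ :=
  GRing.RMorphism.copy (@reduce_coeffs L I n) (map_mpoly (@coset_of_I L I)).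

Lemma coset_of_I_eq0 (x : L) : (coset_of_I I x == 0) = (x \in I).
Proof.
by rewrite -[0](rmorph0 (\pi_({ideal_quot I})%qT)) -Quotient.idealrBE subr0.
Qed.

Lemma mcoeff_reduce_coeffs (p : T) X :
  (reduce_coeffs I p)@_X = coset_of_I I p@_X.
Proof. exact: mcoeff_map_mpoly. Qed.

Lemma coeff_lift_reduce (q : {mpoly {ideal_quot I}[n]}) (p : T) :
  coeff_lift q p -> reduce_coeffs I p = q.
Proof.
move=> lift_p; apply/mpolyP => X; rewrite mcoeff_reduce_coeffs.
by have := lift_p X; case: eqP => [-> ->|//]; rewrite rmorph0.
Qed.

Lemma reduce_coeffs_surj (q : {mpoly {ideal_quot I}[n]}) :
  exists p : T, reduce_coeffs I p = q.
Proof.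
exists (\sum_(X <- msupp q) repr q@_X *: 'X_[X]).
rewrite rmorph_sum [RHS]mpolyE; apply: eq_bigr => X _.
apply/mpolyP => Y; rewrite mcoeff_reduce_coeffs !mcoeffZ !mcoeffX.
by rewrite rmorphM rmorph_nat; congr (_ * _); apply: reprK.
Qed.

End Reduction.

(** * Transfer of cosets from [T/J] to [A/Jbar] *)

Section Cosets.
Variables (L : comNzRingType) (s : nat) (nu : 'I_s -> L) (I : idealr L).
Hypothesis I_nu : forall x, x \in I <-> ideal_span (codom nu) x.
Variables (n t : nat).
Variables (fbar : 'I_t -> {mpoly {ideal_quot I}[n]}) (f : 'I_t -> {mpoly L[n]}).
Hypothesis f_lift : forall i, coeff_lift (fbar i) (f i).

Local Notation Jbar := (ideal_span (codom fbar)).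
Local Notation J := (ideal_span (codom f ++ codom (fun j => (nu j)%:MP_[n]))).

(** Each coefficient is a combination of the [nu j], whose constant polynomials are among the
    generators of [J]. *)
Lemma mem_ideal_coeffs (p : {mpoly L[n]}) : (forall X, p@_X \in I) -> J p.
Proof.
move=> Ip; rewrite [p]mpolyE; apply: ideal_mem_sum => X _.
rewrite -mul_mpolyC mulrC; apply: ideal_memM.
move: (Ip X) => /I_nu; rewrite -[J _]/(preim_ideal (@mpolyC n L) J _).
apply: ideal_gen_min => _ /codomP[j ->]; apply: mem_ideal_gen.
by rewrite mem_cat (codom_f (fun j => (nu j)%:MP_[n])) orbT.
Qed.

Lemma mem_ideal_reduce (p : {mpoly L[n]}) : Jbar (reduce_coeffs I p) <-> J p.
Proof.
split=> [[c cP def_p]|].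
  (* Lift the combination of the [fbar i] term by term: multipliers by surjectivity, and [fbar i] to
     [f i]. *)
  have [h Jh hE] : exists2 h, J h & reduce_coeffs I h = reduce_coeffs I p.
    rewrite {}def_p big_seq.
    apply: (big_ind (fun q => exists2 h, J h & reduce_coeffs I h = q))
        => [|_ _ [x Jx <-] [y Jy <-]|q /cP].
    - by exists 0; [exact: ideal_mem0 | rewrite rmorph0].
    - by exists (x + y); [exact: ideal_memD | rewrite rmorphD].
    case/codomP=> i ->; have [u <-] := reduce_coeffs_surj q.1.
    exists (u * f i); last by rewrite rmorphM /= (coeff_lift_reduce (f_lift i)).
    by apply/ideal_memM/mem_ideal_gen; rewrite mem_cat codom_f.
  (* The lift [h] and [p] have the same image, so the coefficients of [p - h] lie in [I]. *)
  rewrite -(subrK h p); apply: ideal_memD Jh; apply: mem_ideal_coeffs => X.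
  by rewrite -coset_of_I_eq0 -mcoeff_reduce_coeffs rmorphB /= hE subrr mcoeff0.
(* Conversely, on generators: [f i] maps to [fbar i] and [nu i] maps to zero. *)
rewrite -[Jbar _]/(preim_ideal (@reduce_coeffs L I n) Jbar _).
apply: ideal_gen_min => x /=.
rewrite mem_cat => /orP[] /codomP[i ->].
  by rewrite (coeff_lift_reduce (f_lift i)); apply/mem_ideal_gen/codom_f.
suff -> : reduce_coeffs I (nu i)%:MP_[n] = 0 by apply: (ideal_mem0 Jbar).
apply/mpolyP => X; rewrite mcoeff_reduce_coeffs mcoeffC mcoeff0; apply/eqP.
rewrite coset_of_I_eq0; apply/I_nu; rewrite mulrC.
exact/ideal_memM/mem_ideal_gen/codom_f.
Qed.

(** Lift [abar] by surjectivity; congruence modulo [Jbar] then is congruence modulo [J], for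
    existence and uniqueness alike. *)
Lemma complete_coset_reps_reduce (C : {mpoly L[n]} -> Prop) :
  complete_coset_reps J C ->
  forall abar, exists! h, C h /\ Jbar (abar - reduce_coeffs I h).
Proof.
move=> C_reps abar; have [a <-] := reduce_coeffs_surj abar.
have [h [[Ch Jah] h_uniq]] := C_reps a.
exists h; split=> [|h' [Ch']]; first by rewrite -rmorphB mem_ideal_reduce.
by rewrite -rmorphB mem_ideal_reduce => Jah'; apply: h_uniq.
Qed.

End Cosets.

(** * Leading monomials and totally reduced polynomials *)

Section TotallyReduced.
Variables (L : comNzRingType) (n : nat) (le : rel 'X_{1..n}).
Hypothesis le_mon : monomial_order le.
Local Notation T := {mpoly L[n]}.
Implicit Types (p q h : T) (X Y m : 'X_{1..n}) (G : seq T).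

(* If m < 0 then 0 > m > 2 m > ... is an infinite descent. *)
Lemma monomial_order0 m : le 0%MM m.
Proof.
have [//|] := orP (mon_total le_mon 0%MM m).
have [-> //|m_neq0 le_m0] := eqVneq m 0%MM.
suff no_acc X : Acc (fun m1 m2 => (m1 != m2) && le m1 m2) X -> False.
  by case: (no_acc 0%MM); apply: (mon_wf le_mon).
elim=> {}X _ /(_ (m + X)%MM); apply.
rewrite -{2 4}[X]add0m (mon_add le_mon) // andbT.
by apply: contraNneq m_neq0 => /addIm->.
Qed.

Lemma LM_max p m : m \in msupp p -> le m (LM le p).
Proof.
rewrite /LM; elim: (msupp p) => //= X r IHr; rewrite inE big_cons.
set M := (M in le X M); case: ifP => [leXM|nleXM] /predU1P[->|/IHr leM] //.
  exact: (mon_refl le_mon).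
apply: (mon_trans le_mon) leM _.
by have := mon_total le_mon X M; rewrite nleXM.
Qed.

Lemma LM_supp p : p != 0 -> LM le p \in msupp p.
Proof.
rewrite -msupp_eq0 => p_neq0.
(* The maximum starts from [0%MM], so that value has to be allowed first. If it is attained, any
   support monomial lies both below and above [0%MM], hence equals it. *)
have: LM le p \in 0%MM :: msupp p.
  rewrite /LM; elim: (msupp p) => [|X r IHr]; first by rewrite big_nil inE.
  rewrite big_cons; case: ifP => _; last by rewrite !inE eqxx orbT.
  by move: IHr; rewrite !inE => /orP[-> | ->] //; rewrite !orbT.
rewrite inE => /predU1P[LM0|//].
case def_r: (msupp p) p_neq0 => [//|X r] _; rewrite -def_r.
have Xp : X \in msupp p by rewrite def_r mem_head.
suff -> : LM le p = X by [].
by apply: (mon_anti le_mon); rewrite LM_max // LM0 monomial_order0.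
Qed.

Lemma LC_neq0 p : p != 0 -> LC le p != 0.
Proof. by move=> /LM_supp; rewrite mcoeff_msupp. Qed.

Lemma mcoeff_neq0_le p m : p@_m != 0 -> le m (LM le p).
Proof. by rewrite -mcoeff_msupp => /LM_max. Qed.

Lemma lc_ideal_mono G X Y :
  (X <= Y)%MM -> forall c, lc_ideal le G X c -> lc_ideal le G Y c.
Proof.
move=> leXY; apply: ideal_gen_min => _ [g [Gg leX ->]].
by apply: mem_ideal_gen; exists g; split=> //; apply: lepm_trans leX leXY.
Qed.

Section CoefficientwiseIdeal.
Variable G : seq T.

Fact lc_coeffs0 X : lc_ideal le G X (0 : T)@_X.
Proof. by rewrite mcoeff0; apply: ideal_mem0. Qed.

Fact lc_coeffsD p q :
    (forall X, lc_ideal le G X p@_X) -> (forall X, lc_ideal le G X q@_X) ->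
  forall X, lc_ideal le G X (p + q)@_X.
Proof. by move=> ap aq X; rewrite mcoeffD; apply: ideal_memD. Qed.

Fact lc_coeffsM q p :
  (forall X, lc_ideal le G X p@_X) -> forall X, lc_ideal le G X (q * p)@_X.
Proof.
move=> ap X; rewrite mcoeffM; apply: ideal_mem_sum => k /eqP/mnmP X_def.
apply: ideal_memM; apply: (lc_ideal_mono _ (ap _)).
(* The monomial contributed by [p] divides [X], so its coefficient ideal is contained in that of
   [X]. *)
by apply/mnm_lepP => i; rewrite [in leqRHS]X_def mnmDE leq_addl.
Qed.

Definition lc_coeffs_ideal : ideal T :=
  @Ideal T (fun p => forall X, lc_ideal le G X p@_X)
    lc_coeffs0 lc_coeffsD lc_coeffsM.

End CoefficientwiseIdeal.

(** * Coset representatives from a Gröbner basis *)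

Section Groebner.
Variables (J : ideal T) (G : seq T).
Hypothesis G_groebner : groebner_basis le J G.

(** By the Gröbner property [LT h] lies in the ideal generated by the [LT g], hence in
    [lc_coeffs_ideal G]; the claim is read off at the coefficient of [LM h]. *)
Lemma LC_mem_lc_ideal h : J h -> h != 0 -> lc_ideal le G (LM le h) (LC le h).
Proof.
move=> Jh h_neq0; have [_ ltE] := G_groebner.
have: ideal_gen (fun u => exists2 g, g \in G & u = LT le g) (LT le h).
  by apply/ltE/mem_ideal_gen; exists h.
move/(@ideal_gen_min _ _ (lc_coeffs_ideal G)) => LTh.
suff /LTh/(_ (LM le h)) : forall u, (exists2 g, g \in G & u = LT le g) ->
    lc_coeffs_ideal G u.
  by rewrite mcoeffZ mcoeffX eqxx mulr1.
move=> _ [g Gg ->] X; rewrite mcoeffZ mcoeffX.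
case: eqP => [<-|_]; last by rewrite mulr0; apply: ideal_mem0.
rewrite mulr1; apply: mem_ideal_gen.
by exists g; split=> //; apply: lepm_refl.
Qed.

(** Supplies the element of [J] that is subtracted to normalize a coefficient at [X] without
    creating larger monomials. *)
Lemma lc_ideal_witness X c :
    lc_ideal le G X c ->
  exists p, [/\ J p, p@_X = c & forall m, p@_m != 0 -> le m X].
Proof.
case=> d dP ->; rewrite big_seq.
apply: (big_ind (fun c => exists p,
  [/\ J p, p@_X = c & forall m, p@_m != 0 -> le m X])).
- by exists 0; split=> [||m]; rewrite ?mcoeff0 ?eqxx //; apply: ideal_mem0.
- move=> _ _ [p [Jp <- leX_p]] [q [Jq <- leX_q]]; exists (p + q).
  split=> [||m]; rewrite ?mcoeffD //; first exact: ideal_memD.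
  by have [->|/leX_p//] := eqVneq p@_m 0; rewrite add0r => /leX_q.
move=> [a _] /dP /= [g [Gg le_gX ->]].
have [G_J _] := G_groebner; have [_ Jg] := G_J g Gg.
(* As [LM g] divides [X], this shift moves the leading term of [g] to [X]; compatibility of the
   order with addition keeps the other terms below. *)
exists (a *: (g * 'X_[X - LM le g])); split=> [||m].
- by rewrite -mul_mpolyC [g * _]mulrC; do 2!apply: ideal_memM.
- by rewrite mcoeffZ -{1}(submK le_gX) mcoeffMX.
rewrite mcoeffZ => am_neq0.
have: m \in msupp (g * 'X_[X - LM le g]).
  by rewrite mcoeff_msupp; apply: contraNneq am_neq0 => ->; rewrite mulr0.
rewrite (perm_mem (msuppMX _ _)) => /mapP[k gk ->].
by rewrite -{2}(submK le_gX) addmC [X in le _ X]addmC (mon_add le_mon) // LM_max.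
Qed.

Variable E : effective_coset_reps L.

(** The bound on the support of [h] is carried through the induction so that a term added at [X]
    meets no earlier one. *)
Lemma totally_reduced_exists_le X p :
    (forall m, p@_m != 0 -> le m X) ->
  exists h, [/\ totally_reduced le E G h, J (p - h)
              & forall m, h@_m != 0 -> le m X].
Proof.
elim/(well_founded_ind (mon_wf le_mon)): X p => X IH p leX_p.
pose c := Defs.repr_of (E (lc_ideal le G X)) p@_X.
have [q [Jq qX leX_q]] :=
  lc_ideal_witness (repr_of_mod (E (lc_ideal le G X)) p@_X).
(* The coefficient of [q] at [X] is that of [p] minus [c], so [r] has none there and lives strictly
   below [X]. *)
pose r := p - q - c *: 'X_[X].
have rX : r@_X = 0.
  by rewrite !mcoeffB qX mcoeffZ mcoeffX eqxx mulr1 opprB addrCA subrr addr0 subrr.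
have ltX_r m : r@_m != 0 -> (m != X) && le m X.
  have [->|neq_mX] := eqVneq m X; first by rewrite rX eqxx.
  rewrite !mcoeffB mcoeffZ mcoeffX [X == m]eq_sym (negPf neq_mX) mulr0 subr0.
  by have [->|/leX_p//] := eqVneq p@_m 0; rewrite sub0r oppr_eq0 => /leX_q.
have [h [h_red Jrh ltX_h]] : exists h, [/\ totally_reduced le E G h, J (r - h)
    & forall m, h@_m != 0 -> (m != X) && le m X].
  (* Zero is treated apart: [LM 0] is the default [0%MM], which need not be strictly below [X]. *)
  have [->|r_neq0] := eqVneq r 0.
    exists 0; split=> [m||m]; rewrite ?mcoeff0 ?eqxx //; first exact: reps0.
    by rewrite subr0; apply: ideal_mem0.
  have /ltX_r ltX := LC_neq0 r_neq0; have /andP[neqX leX] := ltX.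
  have [h [h_red Jrh le_h]] := IH _ ltX r (@mcoeff_neq0_le r).
  exists h; split=> // m /le_h le_m; rewrite (mon_trans le_mon le_m leX) andbT.
  apply: contra_neq neqX => eq_mX; apply: (mon_anti le_mon).
  by rewrite leX -eq_mX.
have hX : h@_X = 0 by apply/eqP/contraT => /ltX_h; rewrite eqxx.
exists (h + c *: 'X_[X]); split=> [m||m].
- rewrite mcoeffD mcoeffZ mcoeffX; case: eqP => [<-|_].
    by rewrite hX add0r mulr1; apply: repr_of_in.
  by rewrite mulr0 addr0; apply: h_red.
- rewrite (_ : _ - _ = (r - h) + q); first exact: ideal_memD.
  by rewrite opprD addrA [r - h + q]addrAC [r + q]addrAC subrK [RHS]addrAC.
rewrite mcoeffD mcoeffZ mcoeffX; case: (eqVneq X m) => [<- _|_].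
  exact: (mon_refl le_mon).
by rewrite mulr0 addr0 => /ltX_h/andP[].
Qed.

Lemma totally_reduced_unique h1 h2 :
    totally_reduced le E G h1 -> totally_reduced le E G h2 -> J (h1 - h2) ->
  h1 = h2.
Proof.
move=> red1 red2 J12; apply/eqP; rewrite -subr_eq0; apply/contraT => neq0.
have := LC_mem_lc_ideal J12 neq0; have := LC_neq0 neq0.
rewrite /LC mcoeffB; set X := LM le _ => LC_neq0 LC_in.
(* The coefficients of [h1] and [h2] at [X] both represent the coset of the former, so both equal
   [c], although their difference is a leading coefficient. *)
have [c [_ c_uniq]] := reps_complete (E (lc_ideal le G X)) h1@_X.
have c1 : c = h1@_X.
  by apply: c_uniq; split; [apply: red1 | rewrite subrr; apply: ideal_mem0].
have c2 : c = h2@_X by apply: c_uniq; split; [apply: red2 | ].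
by rewrite -c1 -c2 subrr eqxx in LC_neq0.
Qed.

Lemma totally_reduced_complete :
  complete_coset_reps J (totally_reduced le E G).
Proof.
move=> p; have [h [h_red Jph _]] := totally_reduced_exists_le (@mcoeff_neq0_le p).
exists h; split=> // h' [h'_red Jph'].
apply: totally_reduced_unique => //.
(* Here [h - h'] is written as [(p - h') - (p - h)]. *)
by rewrite -(subrKA p) -[h - p]opprB addrC; apply: ideal_memB.
Qed.

End Groebner.

End TotallyReduced.

Theorem proposition2p5
  (L : comNzRingType) (noethL : noetherian L)
  (linL : linear_equations_solvable L) (E : effective_coset_reps L)
  (s : nat) (nu : 'I_s -> L)
  (I : idealr L) (I_nu : forall x, x \in I <-> ideal_span (codom nu) x)
  (n t : nat)
  (fbar : 'I_t -> {mpoly {ideal_quot I}[n]}) (f : 'I_t -> {mpoly L[n]})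
  (f_lift : forall i, coeff_lift (fbar i) (f i))
  (le : rel 'X_{1..n}) (le_mon : monomial_order le)
  (G : seq {mpoly L[n]}) :
  let Jbar := ideal_span (codom fbar) in
  let J := ideal_span (codom f ++ codom (fun j => (nu j)%:MP_[n])) in
  let phi : {mpoly L[n]} -> {mpoly {ideal_quot I}[n]} := @reduce_coeffs L I n in
  let represents_once (C : {mpoly L[n]} -> Prop) :=
    forall abar : {mpoly {ideal_quot I}[n]},
      exists! h : {mpoly L[n]}, C h /\ Jbar (abar - phi h) in
  groebner_basis le J G ->
  [/\ forall C, complete_coset_reps J C -> represents_once C,
      complete_coset_reps J (totally_reduced le E G)
    & represents_once (totally_reduced le E G)].
Proof.
move=> Jbar J phi represents_once G_groebner.
have C_once C : complete_coset_reps J C -> represents_once C.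
  exact: (complete_coset_reps_reduce I_nu f_lift).
have red_complete := totally_reduced_complete le_mon G_groebner E.
by split=> //; apply: C_once.
Qed.
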